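(* Let $\eta\in\Omega_{<\infty}$. For any $k\in\mathbb N$ and $i\in\mathbb Z_{\ge0}$, $$\Phi_k(\eta)=\Psi_k(\eta),\qquad J^{10}_k(\eta,i)=\zeta_k(\eta,i).$$
   Context: $\mathbb N=\{1,2,\dots\}$ and $\Omega_{<\infty}=\{\eta\in\{0,1\}^{\mathbb Z_{\ge0}}:\eta(0)=0,\ \sum_{x\in\mathbb N}\eta(x)<\infty\}$. **10-elimination.** For $\eta\in\Omega_{<\infty}$, remove simultaneously all neighbouring pairs of sites $(x,x+1)$ with $\eta(x)=1,\eta(x+1)=0$ (these pairs are disjoint). Let $0=y_0<y_1<y_2<\cdots$ be the remaining sites, $\eta'(i)=\eta(y_i)$, and $j(\eta,i)=(y_{i+1}-y_i-1)/2\in\mathbb Z_{\ge0}$ the number of removed pairs between $y_i$ and $y_{i+1}$; i.e. $\eta=\eta'(0)(10)^{j(\eta,0)}\eta'(1)(10)^{j(\eta,1)}\eta'(2)\cdots$. Put $\Phi_1(\eta)=\eta'(0)\eta'(1)\eta'(2)\cdots\in\Omega_{<\infty}$. The 10-rigging is $$J^{10}_1(\eta,i)=\begin{cases} j(\eta,i) & \text{if } j(\eta,i)\ge1,\ (\eta'(i),\eta'(i+1))\in\{(0,0),(0,1),(1,1)\},\\ j(\eta,i)-1 & \text{if } j(\eta,i)\ge2,\ (\eta'(i),\eta'(i+1))=(1,0),\\ 0&\text{otherwise.}\end{cases}$$ Recursively $\Phi_{k+1}(\eta)=\Phi_1(\Phi_k(\eta))$ and $J^{10}_{k+1}(\eta,\cdot)=J^{10}_1(\Phi_k(\eta),\cdot)$.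 **Seat number configuration and skip map.** For $k\in\mathbb N$, $\mathcal W_k(\eta,\cdot):\mathbb Z_{\ge0}\to\{0,1\}$ is defined by $\mathcal W_k(\eta,0)=0$ and, for $x\ge1$, $\mathcal W_k(\eta,x)=\mathcal W_k(\eta,x-1)+\eta^{\uparrow}_k(x)-\eta^{\downarrow}_k(x)$, where $$\eta^{\uparrow}_k(x)=\eta(x)(1-\mathcal W_k(\eta,x-1))\prod_{j=1}^{k-1}\mathcal W_j(\eta,x-1),\qquad \eta^{\downarrow}_k(x)=(1-\eta(x))\mathcal W_k(\eta,x-1)\prod_{j=1}^{k-1}(1-\mathcal W_j(\eta,x-1)).$$ Let $\xi_k(\eta,0)=0$, $\xi_k(\eta,x)=x-\sum_{y=1}^{x}\sum_{j=1}^{k}(\eta^\uparrow_j(y)+\eta^\downarrow_j(y))$, and $s_k(\eta,i)=\min\{x\in\mathbb Z_{\ge0}:\xi_k(\eta,x)=i\}$ (finite for $\eta\in\Omega_{<\infty}$). Then $\Psi_k(\eta)(x)=\eta(s_k(\eta,x))$ for $x\in\mathbb Z_{\ge0}$ and $$\zeta_k(\eta,i)=\sum_{y=s_k(\eta,i)+1}^{s_k(\eta,i+1)}\big(\eta^{\uparrow}_k(y)-\eta^{\uparrow}_{k+1}(y)\big).$$ *)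

(* Defs.v *)
From mathcomp Require Import all_boot all_order all_algebra.
From mathcomp Require Import boolp.
Set Implicit Arguments. Unset Strict Implicit. Unset Printing Implicit Defensive.
Import Order.TTheory GRing.Theory Num.Theory.

Local Open Scope ring_scope.

Definition config := nat -> bool.

(* Nonnegative terms: the series over [x >= 1] is finite iff its partial sums
   are bounded. *)
Definition finite_config (eta : config) : Prop :=
  eta 0%N = false /\
  exists M : nat, forall n : nat, (\sum_(1 <= x < n.+1) eta x <= M)%N.

(* [min {n | P n}]; the junk value 0 is used when the set is empty. *)
Definition least (P : pred nat) : nat :=
  match pselect (exists n, P n) with
  | left exP => ex_minn exP
  | right _ => 0%N
  end.

Definition pair10 (eta : config) (x : nat) : bool := eta x && ~~ eta x.+1.

Definition removed (eta : config) (x : nat) : bool :=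
  pair10 eta x || ((0 < x)%N && pair10 eta x.-1).

(* Site 0 always remains, since [eta 0 = 0]. *)
Fixpoint remaining (eta : config) (i : nat) : nat :=
  if i is i'.+1
  then least (fun x => (remaining eta i' < x)%N && ~~ removed eta x)
  else 0%N.

Definition Phi1 (eta : config) : config := fun i => eta (remaining eta i).

Definition removed_pairs (eta : config) (i : nat) : nat :=
  (remaining eta i.+1 - remaining eta i - 1)./2.

Definition rigging1 (eta : config) (i : nat) : nat :=
  let j := removed_pairs eta i in
  match Phi1 eta i, Phi1 eta i.+1 with
  | true, false => if (2 <= j)%N then (j - 1)%N else 0%N
  | _, _ => if (1 <= j)%N then j else 0%N
  end.

Definition Phi (k : nat) (eta : config) : config := iter k Phi1 eta.

(* Meaningful for [k >= 1] only. *)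
Definition rigging (k : nat) (eta : config) (i : nat) : nat :=
  rigging1 (Phi k.-1 eta) i.

(* [b] is the value of the configuration at [x], and [w j] the value of the
   [j]-th seat number configuration at [x - 1]. *)
Definition step_up (b : bool) (w : nat -> int) (k : nat) : int :=
  (b : nat)%:Z * (1 - w k) * \prod_(1 <= j < k) w j.

Definition step_down (b : bool) (w : nat -> int) (k : nat) : int :=
  (1 - (b : nat)%:Z) * w k * \prod_(1 <= j < k) (1 - w j).

(* Only the seat numbers [k >= 1] are meaningful; the position [x] comes first
   because the recursion runs on it simultaneously for all [k]. *)
Fixpoint seat_rec (eta : config) (x : nat) : nat -> int :=
  if x is x'.+1 then
    let w := seat_rec eta x' in
    fun k => w k + step_up (eta x) w k - step_down (eta x) w k
  else fun=> 0.

Definition seat (k : nat) (eta : config) (x : nat) : int := seat_rec eta x k.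

(* [seat_up] and [seat_down] are only used at positions [x >= 1]. *)
Definition seat_up (k : nat) (eta : config) (x : nat) : int :=
  step_up (eta x) (fun j => seat j eta x.-1) k.

Definition seat_down (k : nat) (eta : config) (x : nat) : int :=
  step_down (eta x) (fun j => seat j eta x.-1) k.

Definition xi (k : nat) (eta : config) (x : nat) : int :=
  x%:Z - \sum_(1 <= y < x.+1) \sum_(1 <= j < k.+1)
           (seat_up j eta y + seat_down j eta y).

Definition skip_site (k : nat) (eta : config) (i : nat) : nat :=
  least (fun x => xi k eta x == i%:Z).

Definition Psi (k : nat) (eta : config) : config :=
  fun x => eta (skip_site k eta x).

Definition zeta (k : nat) (eta : config) (i : nat) : int :=
  \sum_((skip_site k eta i).+1 <= y < (skip_site k eta i.+1).+1)
    (seat_up k eta y - seat_up k.+1 eta y).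

(* Main.v *)
Require Import Defs.
From mathcomp Require Import all_boot all_order all_algebra.
From mathcomp Require Import boolp zify ring.
Set Implicit Arguments. Unset Strict Implicit. Unset Printing Implicit Defensive.
Import GRing.Theory.

(** Let [y_i] be the [i]-th site that survives the 10-elimination, and put
    [t_i = y_i + eta (y_i)].  A surviving 1 is followed by a 1 and a surviving
    0 is preceded by a 0, so the [t_i] with [i >= 1] enumerate the sites
    [x >= 1] with [eta x = eta x.-1], and [eta (t_i) = eta (y_i)].  Since
    [W_1 = eta], these are also the sites skipped to by [s_1], whence
    [Phi_1 = Psi_1].  The seats [2, 3, ...] move only at the sites [t_i], where
    they follow the dynamics of the seats [1, 2, ...] driven by [Phi_1 eta];
    so [s_(k+1) eta = t \o s_k (Phi_1 eta)], and both claims for [k + 1] at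
    [eta] reduce to the claims for [k] at [Phi_1 eta].  For [k = 1], [eta]
    alternates strictly between [t_i] and [t_(i+1)], so [zeta_1] counts the
    rises of an alternating word, with [eta_2^up] contributing only when
    [(eta' i, eta' (i + 1)) = (0, 1)]. *)

(** * Least elements and configurations of finite support *)

Lemma leastP (P : pred nat) (n : nat) : P n ->
  P (least P) /\ forall m, P m -> least P <= m.
Proof.
rewrite /least => Pn; case: pselect => [exP|]; last by case; exists n.
by case: ex_minnP.
Qed.

Lemma least_eq (P : pred nat) (n : nat) :
  P n -> (forall m, P m -> n <= m) -> least P = n.
Proof.
move=> Pn minn; have [Pl minl] := leastP Pn.
by apply/eqP; rewrite eqn_leq minl // minn.
Qed.

Lemma least_none (P : pred nat) : (forall n, ~~ P n) -> least P = 0.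
Proof.
move=> nP; rewrite /least; case: pselect => // exP.
by exfalso; case: exP => n; apply/negP.
Qed.

(** This form of finiteness passes easily to [Phi1 eta], because the [i]-th survivor lies at a site
    at least [i]. *)
Definition eventually_zero (eta : config) : Prop :=
  eta 0 = false /\ exists N, forall x, N <= x -> eta x = false.

Lemma finite_config_eventually_zero (eta : config) :
  finite_config eta -> eventually_zero eta.
Proof.
case=> eta0 [M bnd]; split=> //.
pose S n := \sum_(1 <= x < n.+1) eta x.
have SltS a x : a < x -> S a + eta x <= S x.
  case: x => // x ax; rewrite /S [leqRHS]big_nat_recr //= leq_add2r.
  by rewrite [leqRHS](@big_cat_nat _ _ _ a.+1) ?leq_addr.
have Sbnd n : S n <= S 0 + M by rewrite (leq_trans (bnd n)) ?leq_addl.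
(* The origin becomes a variable site [a] past which at most [M] ones remain; moving [a] onto the
   next 1 lowers [M] by one. *)
move: 0 Sbnd => a; elim: M a {bnd} => [|M IHM] a Sbnd.
  exists a.+1 => x ax; have := SltS _ _ ax; have := Sbnd x.
  by case: (eta x) => //; lia.
have [[x [ax etax]]|none] := pselect (exists x, a < x /\ eta x); last first.
  by exists a.+1 => x ax; apply/negP => etax; apply: none; exists x.
apply: (IHM x) => n; have := Sbnd n; have := SltS _ _ ax.
by rewrite etax; lia.
Qed.

(** * Surviving sites and repeat sites *)

Arguments remaining : simpl never.

Section Remaining.

Variable eta : config.
Hypothesis eta_ez : eventually_zero eta.

Local Notation y := (remaining eta).

Let eta0 : eta 0 = false. Proof. by case: eta_ez. Qed.

Let removed0 : removed eta 0 = false.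
Proof. by rewrite /removed /pair10 eta0. Qed.

Lemma remaining_next i :
  [/\ y i < y i.+1, ~~ removed eta (y i.+1)
    & forall x, y i < x -> ~~ removed eta x -> y i.+1 <= x].
Proof.
pose P x := (y i < x) && ~~ removed eta x.
have [N etaN] := proj2 eta_ez.
(* This site and its left neighbour both carry 0, so it survives and [least] does not take its
   default value. *)
have PN : P (maxn N (y i)).+2.
  rewrite /P /removed /pair10 /= !etaN ?andbF //; lia.
have [/andP[lt_y nrem] minP] := leastP PN.
by split=> // x yx nremx; apply: minP; rewrite /P yx.
Qed.

Lemma remaining_nremoved i : ~~ removed eta (y i).
Proof. by case: i => [|i]; [rewrite removed0 | case: (remaining_next i)]. Qed.

Lemma Phi1_eventually_zero : eventually_zero (Phi1 eta).
Proof.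
split=> //; have [N etaN] := proj2 eta_ez; exists N => x Nx.
apply: etaN; apply: leq_trans Nx _.
by elim: x => // x IHx; case: (remaining_next x); lia.
Qed.

Definition repeat_site (i : nat) : nat := y i + eta (y i).

Local Notation t := repeat_site.

Lemma repeat_site0 : t 0 = 0.
Proof. by rewrite /t /= eta0. Qed.

Lemma eta_repeat_site i : eta (t i) = Phi1 eta i.
Proof.
rewrite /t /Phi1; case etay : (eta (y i)); last by rewrite addn0.
have := remaining_nremoved i; rewrite /removed /pair10 etay addn1.
by case: (eta _.+1).
Qed.

(** The only possible clash is a surviving 1 with the next survivor adjacent to it; that one is then
    also a 1, so its repeat site is shifted too. *)
Lemma ltn_repeat_site i : t i < t i.+1.
Proof.
have [lt_y _ _] := remaining_next i; have := eta_repeat_site i.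
rewrite /t /Phi1; case etay: (eta (y i)); last by lia.
rewrite addn1 => etay1; have [eq_y|ne_y] := eqVneq (y i.+1) (y i).+1.
  by rewrite eq_y etay1; lia.
by move: ne_y lt_y; lia.
Qed.

Lemma repeat_siteP i : eta (t i.+1).-1 = eta (t i.+1).
Proof.
have := eta_repeat_site i.+1; have [lt_y _ _] := remaining_next i.
have := remaining_nremoved i.+1; rewrite /t /Phi1 /removed /pair10.
case etay: (eta (y i.+1)); first by rewrite addn1 /= etay.
have y_gt0 : 0 < y i.+1 by lia.
by rewrite y_gt0 /= addn0 prednK // etay andbT => /negbTE.
Qed.

(** A repetition at [x] would create a forbidden survivor: [x] itself for 00, and [x.-1] for 11. *)
Lemma alternate i x : t i < x < t i.+1 -> eta x = ~~ eta x.-1.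
Proof.
case/andP=> tix xti; have [lt_y _ miny] := remaining_next i.
have x_gt0 : 0 < x by lia.
have xy : x <= y i.+1 by move: xti; rewrite /t; case: (eta (y i.+1)); lia.
have yx : y i < x by move: tix; rewrite /t; lia.
case etax : (eta x); case etax1 : (eta x.-1) => //; last first.
  have xE : x = y i.+1.
    apply/eqP; rewrite eqn_leq xy miny // /removed /pair10 etax x_gt0 etax1.
    by [].
  by move: xti; rewrite /t -xE etax; lia.
have [eq_y|ne_y] := eqVneq x.-1 (y i).
  by move: tix; rewrite /t -eq_y etax1; lia.
suff : y i.+1 <= x.-1 by lia.
apply: miny; first by move: ne_y; lia.
rewrite /removed /pair10 prednK // etax etax1 /=.
by case: (ltnP 0 x.-1) => // x1_gt0; rewrite prednK // etax1 andbF.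
Qed.

End Remaining.

Lemma leq_repeat_site (eta : config) (a b : nat) :
  eventually_zero eta -> a <= b -> repeat_site eta a <= repeat_site eta b.
Proof.
move=> He; elim: b => [|b IHb]; first by rewrite leqn0 => /eqP->.
rewrite leq_eqVlt => /predU1P[->//|/IHb]; have := ltn_repeat_site He b; lia.
Qed.

(** Rises occupy every second site, beginning with the first one exactly when [eta a] is 0; this
    decides the rounding. *)
Lemma alternate_sum (eta : config) (a n : nat) :
  (forall x, (a < x < a + n.+1) -> eta x = ~~ eta x.-1) ->
  eta (a + n) = eta a (+) odd n /\
  \sum_(a.+1 <= x < (a + n).+1) (eta x && ~~ eta x.-1) = (n + ~~ eta a)./2.
Proof.
elim: n => [|n IHn] alt.
  by rewrite addn0 addbF big_geq //; case: (eta a).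
have [|etan sumn] := IHn; first by move=> x lt_x; apply: alt; lia.
have etaS : eta (a + n.+1) = ~~ eta (a + n) by rewrite alt addnS //; lia.
rewrite etaS etan; split; first by rewrite /= addbN.
rewrite addnS big_nat_recr /=; last lia.
rewrite sumn -addnS etaS etan.
by case: (eta a); case oddn: (odd n) => /=; lia.
Qed.

Local Open Scope ring_scope.

(** The change of variables used to compare both [xi] and [zeta] with their values at [Phi1 eta]. *)
Lemma sum_repeat_site (eta : config) (f : nat -> int) (a b : nat) :
  eventually_zero eta ->
  (forall i x, (repeat_site eta i < x < repeat_site eta i.+1)%N -> f x = 0) ->
  \sum_((repeat_site eta a).+1 <= x < (repeat_site eta b).+1) f x =
  \sum_(a.+1 <= m < b.+1) f (repeat_site eta m).
Proof.
move=> He f0; have [leab|ltba] := leqP a b; last first.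
  by rewrite !big_geq // ltnS ?leq_repeat_site // ltnW.
elim: b leab => [|b IHb].
  by rewrite leqn0 => /eqP->; rewrite !big_geq.
rewrite leq_eqVlt => /predU1P[->|leab]; first by rewrite !big_geq.
rewrite [RHS]big_nat_recr // -IHb //=.
rewrite (@big_cat_nat _ _ _ (repeat_site eta b).+1) //=.
- congr (_ + _); have lt_t := ltn_repeat_site He b.
  rewrite big_nat_recr //= big_nat big1 ?add0r // => x.
  exact: f0.
- by rewrite ltnS leq_repeat_site.
- by rewrite ltnS ltnW // ltn_repeat_site.
Qed.

(* For seats in {0, 1}, the indicator that none of the seats 1, ..., k moves. *)
Definition step_keep (b : bool) (w : nat -> int) (k : nat) : int :=
  (b : nat)%:Z * \prod_(1 <= j < k.+1) w j
  + (1 - (b : nat)%:Z) * \prod_(1 <= j < k.+1) (1 - w j).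

(** The sum telescopes: the moves of seat [k.+1] add up to [step_keep b w k - step_keep b w k.+1],
    for arbitrary integers [w]. *)
Lemma sum_step (b : bool) (w : nat -> int) (k : nat) :
  \sum_(1 <= j < k.+1) (step_up b w j + step_down b w j) = 1 - step_keep b w k.
Proof.
elim: k => [|k IHk]; first by rewrite /step_keep !big_geq //; ring.
rewrite big_nat_recr // IHk /step_keep /step_up /step_down /=.
rewrite ![\prod_(1 <= j < k.+2) _]big_nat_recr //=; ring.
Qed.

Lemma xiE (k : nat) (eta : config) (x : nat) :
  xi k eta x =
  \sum_(1 <= m < x.+1) step_keep (eta m) (fun j => seat j eta m.-1) k.
Proof.
rewrite /xi; under eq_bigr do rewrite sum_step.
by rewrite sumrB sumr_const_nat subn1 /= natz opprB addrC subrK.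
Qed.

(** * One seat step at repeated and at alternating sites *)

Lemma prod_shift (f g : nat -> int) (k : nat) :
  f 1%N = 1 -> (forall j, (0 < j)%N -> f j.+1 = g j) ->
  \prod_(1 <= j < k.+1) f j = \prod_(1 <= j < k) g j.
Proof.
move=> f1 fg; case: k => [|k]; first by rewrite !big_geq.
by rewrite big_ltn // f1 mul1r big_add1 /=; apply: eq_big_nat => j /andP[/fg].
Qed.

Lemma prod_zero (f : nat -> int) (k : nat) :
  f 1%N = 0 -> (0 < k)%N -> \prod_(1 <= j < k.+1) f j = 0.
Proof. by move=> f1 k0; rewrite big_ltn // f1 mul0r. Qed.

Section StepRepeat.

Variables (b : bool) (w w' : nat -> int) (k : nat).
Hypothesis w1 : w 1%N = (b : nat)%:Z.
Hypothesis ww' : forall j, (0 < j)%N -> w j.+1 = w' j.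

(** Seat 1 already equals [b], so its factor is 1 and drops out, which lowers every seat index by
    one. *)
Lemma step_up_repeat : (0 < k)%N -> step_up b w k.+1 = step_up b w' k.
Proof.
move=> k0; rewrite /step_up ww' //; case: b w1 => w1b; last by rewrite !mul0r.
by rewrite (prod_shift _ w1b ww').
Qed.

Lemma step_down_repeat : (0 < k)%N -> step_down b w k.+1 = step_down b w' k.
Proof.
move=> k0; rewrite /step_down ww' //; case: b w1 => w1b.
  by rewrite subrr !mul0r.
rewrite (@prod_shift (fun j => 1 - w j) (fun j => 1 - w' j)) //.
  by rewrite w1b subr0.
by move=> j /ww' ->.
Qed.

Lemma step_keep_repeat : step_keep b w k.+1 = step_keep b w' k.
Proof.
rewrite /step_keep; case: b w1 => w1b.
  by rewrite subrr !mul0r (prod_shift _ w1b ww').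
rewrite !mul0r (@prod_shift (fun j => 1 - w j) (fun j => 1 - w' j)) //.
  by rewrite w1b subr0.
by move=> j /ww' ->.
Qed.

End StepRepeat.

Section StepAlternate.

Variables (b : bool) (w : nat -> int) (k : nat).
Hypothesis w1 : w 1%N = (~~ b : nat)%:Z.

(** Seat 1 differs from [b], so it contributes a zero factor that blocks all later seats. *)
Lemma step_up_alternate : (0 < k)%N -> step_up b w k.+1 = 0.
Proof.
rewrite /step_up; case: b w1 => w1b k0; last by rewrite !mul0r.
by rewrite prod_zero // mulr0.
Qed.

Lemma step_down_alternate : (0 < k)%N -> step_down b w k.+1 = 0.
Proof.
rewrite /step_down; case: b w1 => w1b k0; first by rewrite subrr !mul0r.
by rewrite (@prod_zero (fun j => 1 - w j)) ?mulr0 // w1b subrr.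
Qed.

Lemma step_keep_alternate : step_keep b w k.+1 = 0.
Proof.
rewrite /step_keep; case: b w1 => w1b.
  by rewrite subrr mul0r prod_zero ?mulr0.
by rewrite mul0r (@prod_zero (fun j => 1 - w j)) ?mulr0 // w1b subrr.
Qed.

End StepAlternate.

Lemma seat1 (eta : config) (x : nat) :
  eta 0%N = false -> seat 1 eta x = (eta x : nat)%:Z.
Proof.
move=> eta0; elim: x => [|x IHx]; first by rewrite eta0.
rewrite /seat /= -/(seat 1 eta x) /step_up /step_down !big_geq //.
rewrite -/(seat 1 eta x) IHx.
by case: (eta x); case: (eta x.+1).
Qed.

Lemma seatS (k : nat) (eta : config) (x : nat) :
  seat k eta x.+1 = seat k eta x + seat_up k eta x.+1 - seat_down k eta x.+1.
Proof. by []. Qed.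

(** * Transfer of seats, [xi] and [zeta] from [eta] to [Phi1 eta] *)

Section ShiftSeats.

Variable eta : config.
Hypothesis eta_ez : eventually_zero eta.

Local Notation t := (repeat_site eta).

Let seat1_alternate (i x : nat) :
  (t i < x < t i.+1)%N -> seat 1 eta x.-1 = (~~ eta x : nat)%:Z.
Proof.
move=> tx; rewrite seat1; last by case: eta_ez.
by rewrite (alternate eta_ez tx) negbK.
Qed.

Lemma seat_up_alternate (k i x : nat) :
  (0 < k)%N -> (t i < x < t i.+1)%N -> seat_up k.+1 eta x = 0.
Proof.
by move=> k0 tx; rewrite /seat_up step_up_alternate // (seat1_alternate tx).
Qed.

Lemma seat_const (k i n : nat) :
  (0 < k)%N -> (t i + n < t i.+1)%N ->
  seat k.+1 eta (t i + n) = seat k.+1 eta (t i).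
Proof.
move=> k0; elim: n => [|n IHn] lt_n; first by rewrite addn0.
have tx : (t i < (t i + n).+1 < t i.+1)%N by rewrite -addnS lt_n addnS; lia.
rewrite addnS seatS (seat_up_alternate k0 tx) /seat_down step_down_alternate //.
  by rewrite IHn; [ring | lia].
exact: seat1_alternate tx.
Qed.

Let seat_last (k i : nat) :
  (0 < k)%N -> seat k.+1 eta (t i.+1).-1 = seat k.+1 eta (t i).
Proof.
move=> k0; have lt_t := ltn_repeat_site eta_ez i.
have -> : (t i.+1).-1 = (t i + (t i.+1 - t i).-1)%N by lia.
by apply: seat_const => //; lia.
Qed.

Let seat1_last (i : nat) : seat 1 eta (t i.+1).-1 = (eta (t i.+1) : nat)%:Z.
Proof. by rewrite seat1 ?repeat_siteP //; case: eta_ez. Qed.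

Lemma seat_repeat_site (k i : nat) :
  (0 < k)%N -> seat k.+1 eta (t i) = seat k (Phi1 eta) i.
Proof.
(* [k] stays general because one step of a seat involves all lower seats. *)
elim: i k => [|i IHi] k k0; first by rewrite repeat_site0.
have lt_t := ltn_repeat_site eta_ez i.
have ww' j : (0 < j)%N -> seat j.+1 eta (t i.+1).-1 = seat j (Phi1 eta) i.
  by move=> j0; rewrite seat_last // IHi.
rewrite [RHS]seatS -[in LHS](@prednK (t i.+1)); last lia.
rewrite seatS ww' // /seat_up /seat_down prednK /=; last lia.
rewrite (step_up_repeat (seat1_last i) ww') //.
by rewrite (step_down_repeat (seat1_last i) ww') // eta_repeat_site.
Qed.

Let seat_prev (i j : nat) :
  (0 < j)%N -> seat j.+1 eta (t i.+1).-1 = seat j (Phi1 eta) i.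
Proof. by move=> j0; rewrite seat_last // seat_repeat_site. Qed.

Lemma seat_up_repeat_site (k i : nat) :
  (0 < k)%N -> seat_up k.+1 eta (t i.+1) = seat_up k (Phi1 eta) i.+1.
Proof.
move=> k0; rewrite /seat_up (step_up_repeat (seat1_last i) (@seat_prev i)) //.
by rewrite eta_repeat_site.
Qed.

Lemma sum_seat_up (k a b : nat) : (0 < k)%N ->
  \sum_((t a).+1 <= x < (t b).+1) seat_up k.+1 eta x =
  \sum_(a.+1 <= m < b.+1) seat_up k (Phi1 eta) m.
Proof.
move=> k0; rewrite sum_repeat_site //; last first.
  by move=> i x; exact: seat_up_alternate.
by apply: eq_big_nat => -[|m] // _; exact: seat_up_repeat_site.
Qed.

Let keep (k : nat) (x : nat) : int :=
  step_keep (eta x) (fun j => seat j eta x.-1) k.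

Let keep_alternate (k i x : nat) : (t i < x < t i.+1)%N -> keep k.+1 x = 0.
Proof. by move=> tx; apply: step_keep_alternate; exact: seat1_alternate tx. Qed.

Lemma xi_repeat_site (k i : nat) : xi k.+1 eta (t i) = xi k (Phi1 eta) i.
Proof.
rewrite !xiE -{1}(repeat_site0 eta_ez) sum_repeat_site //; last first.
  by move=> j x; exact: keep_alternate.
apply: eq_big_nat => -[|m] // _.
by rewrite (step_keep_repeat _ (seat1_last m) (@seat_prev m)) eta_repeat_site.
Qed.

(** Since [xi] is flat up to the next repeat site, every value it takes is first taken at a repeat
    site. *)
Lemma xi_alternate (k i n : nat) :
  (t i + n < t i.+1)%N -> xi k.+1 eta (t i + n) = xi k.+1 eta (t i).
Proof.
elim: n => [|n IHn] lt_n; first by rewrite addn0.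
rewrite addnS xiE big_nat_recr //= -xiE IHn; last lia.
rewrite -/(keep k.+1 _) (@keep_alternate _ i) ?addr0 //.
by rewrite -addnS lt_n addnS; lia.
Qed.

Lemma repeat_site_bracket (x : nat) : exists i, (t i <= x < t i.+1)%N.
Proof.
elim: x => [|x [i /andP[tix xti]]].
  by exists 0%N; have := ltn_repeat_site eta_ez 0; rewrite repeat_site0.
have [lt_x|le_x] := ltnP x.+1 (t i.+1); first by exists i; rewrite lt_x; lia.
by exists i.+1; have := ltn_repeat_site eta_ez i.+1; lia.
Qed.

(* If no site has index [i], both sides are the junk value 0, as [t 0 = 0]. *)
Lemma skip_siteS (k i : nat) :
  skip_site k.+1 eta i = t (skip_site k (Phi1 eta) i).
Proof.
have xiP x : exists m, (t m <= x)%N /\ xi k.+1 eta x = xi k (Phi1 eta) m.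
  have [m /andP[tmx xtm]] := repeat_site_bracket x; exists m; split=> //.
  by rewrite -(subnKC tmx) xi_alternate ?xi_repeat_site // subnKC.
rewrite /skip_site.
have [[m xim]|none] := pselect (exists m, xi k (Phi1 eta) m == i%:Z).
  have [/= xil minl] := @leastP (fun m => xi k (Phi1 eta) m == i%:Z) m xim.
  apply: least_eq => [|x]; first by rewrite xi_repeat_site.
  have [n [tnx ->]] := xiP x => xin; apply: leq_trans tnx.
  by apply: leq_repeat_site => //; apply: minl.
rewrite !least_none ?repeat_site0 // => x; apply/negP.
  by move=> xix; apply: none; exists x.
by have [m [_ ->]] := xiP x => xim; apply: none; exists m.
Qed.

Lemma PsiS (k : nat) : Psi k.+1 eta = Psi k (Phi1 eta).
Proof. by apply: funext => x; rewrite /Psi skip_siteS eta_repeat_site. Qed.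

Lemma zetaS (k i : nat) : (0 < k)%N -> zeta k.+1 eta i = zeta k (Phi1 eta) i.
Proof. by move=> k0; rewrite /zeta !sumrB !skip_siteS !sum_seat_up. Qed.

End ShiftSeats.

(** * The first elimination and the induction *)

(** Together with [skip_siteS] this identifies [skip_site 1 eta] with [repeat_site eta], which
    starts the induction. *)
Lemma skip_site0 (eta : config) (i : nat) : skip_site 0 eta i = i.
Proof.
have xi0 x : xi 0 eta x = x%:Z.
  by rewrite /xi big1 ?subr0 // => y _; rewrite big_geq.
apply: least_eq => [|m]; rewrite xi0 ?eqxx //.
by move=> /eqP[->].
Qed.

Lemma seat_up1 (eta : config) (x : nat) : eta 0%N = false ->
  seat_up 1 eta x = (eta x && ~~ eta x.-1 : nat)%:Z.
Proof.
move=> eta0; rewrite /seat_up /step_up big_geq // seat1 // mulr1.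
by case: (eta x); case: (eta x.-1).
Qed.

Lemma rigging1E (eta : config) (i : nat) :
  eventually_zero eta -> (rigging1 eta i)%:Z = zeta 1 eta i.
Proof.
move=> He; have eta0 := proj1 He; have lt_t := ltn_repeat_site He i.
rewrite /zeta !(skip_siteS He) !skip_site0 sumrB.
rewrite (@sum_seat_up _ He 1) // big_nat1.
rewrite (@seat_up1 (Phi1 eta)) /=; last exact: eta0.
under eq_bigr do rewrite seat_up1 //.
(* The last site repeats its predecessor, so it is no rise; the [n] sites strictly between the
   repeat sites are left. *)
rewrite big_nat_recr // repeat_siteP // andbN /= addr0.
pose n := (repeat_site eta i.+1 - repeat_site eta i).-1.
have tE : repeat_site eta i.+1 = (repeat_site eta i + n).+1 by rewrite /n; lia.
have [|etan sumn] := @alternate_sum eta (repeat_site eta i) n.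
  by move=> x; rewrite addnS -tE; exact: alternate.

rewrite -(big_morph Posz PoszD (erefl 0%:Z)) tE sumn.
have yE j : repeat_site eta j = (remaining eta j + Phi1 eta j)%N by [].
have [lt_y _ _] := remaining_next He i.
(* This equality ties the parity of [n] to the two surviving values, which makes both halvings
   exact. For the pair (1, 0) [n] is odd, so at least one pair was removed and the subtraction of 1
   never truncates. *)
have : eta (repeat_site eta i.+1) = eta (repeat_site eta i + n)%N.
  by rewrite -repeat_siteP // tE.
rewrite etan !eta_repeat_site // /rigging1 /removed_pairs.
move: (yE i) (yE i.+1).
case: (Phi1 eta i); case: (Phi1 eta i.+1) => /=;
  case oddn: (odd n) => //; case: ltnP; lia.
Qed.

Local Close Scope ring_scope.

Theorem theorem3p2 (eta : config) (heta : finite_config eta)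
    (k : nat) (hk : 0 < k) (i : nat) :
  Phi k eta = Psi k eta /\ Posz (rigging k eta i) = zeta k eta i.
Proof.
case: k hk => // k _; move: (finite_config_eventually_zero heta) => {heta}.
(* [eta] is general because the induction peels off the first elimination and passes to
   [Phi1 eta]. *)
elim: k eta => [|k IHk] eta He.
  split; last exact: rigging1E.
  by rewrite PsiS //; apply: funext => x; rewrite /Psi skip_site0.
have [PhiE rigE] := IHk _ (Phi1_eventually_zero He).
rewrite PsiS // zetaS // -PhiE -rigE.
by rewrite /rigging !succnK /Phi !iterSr.
Qed.
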